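(* Let $\mathcal P$ and $\mathcal Q$ be properties of filtrations as in the context: $\mathcal P\Rightarrow\mathcal Q$, every $\mathcal Q$-filtration consists of normal subgroups, $\gamma_*(G)$ is a $\mathcal Q$-filtration for every group $G$, and every $\mathcal P$-filtration is central. Assume that hypotheses (H0), (H1), (H2), (H3), (H4) of the context hold. Then: (1) For every group $G$, the filtration $\gamma_*^{\mathcal P}(G)$ is an $N$-series. Moreover, if a group $K$ acts on a group $H$ by automorphisms, then: (2) $\gamma_*^{\mathcal P}(H\rtimes K)=\gamma_*^K(H)^{\mathcal P}\rtimes\gamma_*^{\mathcal P}(K)$; (3) If $K$ acts trivially on $\mathrm{gr}_*^{\mathcal P}(H)$, then $\gamma_*^K(H)^{\mathcal P}=\gamma_*^{\mathcal P}(H)$. In particular, if $K$ acts trivially on $\mathrm{gr}_*^{\mathcal P}(H)$, then there is a canonical isomorphism of graded Lie rings $\mathrm{gr}_*^{\mathcal P}(H\rtimes K)\cong\mathrm{gr}_*^{\mathcal P}(H)\rtimes\mathrm{gr}_*^{\mathcal P}(K)$.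
   Context: Commutators are $[a,b]=aba^{-1}b^{-1}$; for subsets $A,B$ of a group, $[A,B]$ is the subgroup generated by all $[a,b]$, $a\in A$, $b\in B$. A filtration $G_*$ on a group $G$ is a sequence of subgroups $G=G_1\supseteq G_2\supseteq\cdots$. It is central if $[G,G_i]\subseteq G_{i+1}$ for all $i\ge1$, and an $N$-series if $[G_i,G_j]\subseteq G_{i+j}$ for all $i,j\ge1$. $G_*\subseteq G'_*$ means termwise inclusion. For $G_*$ central, $\mathrm{gr}(G_* )=\bigoplus_{i\ge1}G_i/G_{i+1}$ is a graded abelian group; if $G_*$ is an $N$-series it is a graded Lie ring, with bracket induced by commutators. $\gamma_*(G)$ is the lower central series: $\gamma_1(G)=G$, $\gamma_{i+1}(G)=[G,\gamma_i(G)]$. If a group $K$ acts on a group $H$ by automorphisms and $H_*$ is a filtration on $H$ by normal subgroups, then for $j\ge1$, $\mathcal A_j(K,H_* )$ is the subgroup of all $k\in K$ such that $k$ and $k^{-1}$ map each $H_i$ into itself and $(k\cdot h)h^{-1}\in H_{i+j}$ for all $i\ge1$, $h\in H_i$. Thus $\mathcal A_*(K,H_* )$ is a filtration on the group $\mathcal A_1(K,H_* )$. Write $\mathcal A_*(H_* )=\mathcal A_*(\mathrm{Aut}(H),H_* )$. Given an action of $K=K_1$ on $H=H_1$, a filtration $K_*$ acts on $H_*$ if $K_j\subseteq\mathcal A_j(K,H_* )$ for all $j\ge1$; then $H_*\rtimes K_*$ denotes the filtration of $H\rtimes K$ with terms $H_i\rtimes K_i$. For a property $\mathcal P$ of filtrations,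 a $\mathcal P$-filtration is a filtration satisfying $\mathcal P$; $\mathcal P\Rightarrow\mathcal Q$ means that every $\mathcal P$-filtration is a $\mathcal Q$-filtration. For a filtration $G_*$, its $\mathcal P$-envelope $G_*^{\mathcal P}$ is the smallest $\mathcal P$-filtration (on the same group) containing $G_*$; it may not exist in general. The hypotheses on $\mathcal P$ and $\mathcal Q$ are: (H0) If $f\colon K\to G$ is a group morphism and $G_*$ is a $\mathcal P$-filtration on $G$, then $f^{-1}(G_* )$ is a $\mathcal P$-filtration on $K$. (H1) If $G_*$ is a $\mathcal P$-filtration, then so is $\mathcal A_*(G_* )$. (H2) If $K_*$ acts on $H_*$ and both $K_*$ and $H_*$ satisfy $\mathcal P$, then so does $H_*\rtimes K_*$. (H3) For every $\mathcal Q$-filtration $G_*$, there is a smallest $\mathcal P$-filtration $G_*^{\mathcal P}$ containing $G_*$. (H4) For every $\mathcal Q$-filtration $G_*$, $\mathcal A_*(G_* )\subseteq\mathcal A_*(G_*^{\mathcal P})$. Put $\gamma_*^{\mathcal P}(G)=\gamma_*(G)^{\mathcal P}$; under the assumptions of the claim it is the smallest $\mathcal P$-filtration on $G$, and its terms are fully invariant subgroups. Put $\mathrm{gr}_*^{\mathcal P}(G)=\mathrm{gr}(\gamma_*^{\mathcal P}(G))$. If $K$ acts on $H$ by automorphisms, it therefore acts on $\mathrm{gr}_*^{\mathcal P}(H)$; when this action is trivial, $H\rtimes K$ is called a $\mathcal P$-almost direct product. The filtration $\gamma_*^K(H)$ on $H$ is defined by $\gamma_1^K(H)=H$, $\gamma_{n+1}^K(H)=[H\rtimes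 K,\gamma_n^K(H)]$ (commutators in $H\rtimes K$). If an $N$-series $K_*$ acts on an $N$-series $H_*$, then $\mathrm{gr}(K_* )$ acts on $\mathrm{gr}(H_* )$ by derivations via $\bar k\cdot\bar h=\overline{(k\cdot h)h^{-1}}$, and $\mathrm{gr}(H_* )\rtimes\mathrm{gr}(K_* )$ is the direct sum with bracket $[(h,k),(h',k')]=([h,h']+k\cdot h'-k'\cdot h,[k,k'])$. In the last statement of the claim, this is applied to $\gamma_*^{\mathcal P}(K)$ acting on $\gamma_*^{\mathcal P}(H)$.
   Formalization: Claim (2) is stated under the added assumption that $\gamma_*^K(H)$ is a $\mathcal Q$-filtration, since it can fail without it even when the envelope $\gamma_*^K(H)^{\mathcal P}$ exists; (1), (3) and the isomorphism are stated without it. *)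

(* Defs.v *)
(* Groups are arbitrary [groupType]s, subsets are classical [set]s.

   Indexing.  A filtration G_1 = G, G_2, G_3, ... is indexed here from 0, so
   that [F n] is the term G_{n+1}.  The condition [G_i, G_j] <= G_{i+j}
   (i, j >= 1) thus reads [F m, F n] <= F (m + n).+1 (m, n >= 0), and the
   degree i + j component of a graded object has index (m + n).+1. *)

From HB Require Import structures.
From mathcomp Require Import all_boot all_algebra generic_quotient.
From mathcomp Require Import boolp classical_sets.

Set Implicit Arguments.
Unset Strict Implicit.
Unset Printing Implicit Defensive.

Import GRing.Theory.
Local Open Scope classical_set_scope.
Local Open Scope quotient_scope.
Local Open Scope group_scope.

(* Lets [S x] be written for [S : subgroup G]. *)
Identity Coercion fun_of_set : set >-> Funclass.

Record subgroup (G : groupType) := Subgroup {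
  sgset :> set G;
  sgclosed : group_closed (mem sgset)
}.

Section SubgroupTheory.
Variables (G : groupType).
Implicit Types (S : subgroup G) (A : set G).

Lemma sg1 S : S 1.
Proof. by have [+ _] := sgclosed S; rewrite inE. Qed.

Lemma sgV S x : S x -> S x^-1.
Proof.
by move=> Sx; have := group_closedV (sgclosed S) (mem_set Sx); rewrite inE.
Qed.

Lemma sgM S x y : S x -> S y -> S (x * y).
Proof.
move=> Sx Sy; have := group_closedM (sgclosed S) (mem_set Sx) (mem_set Sy).
by rewrite inE.
Qed.

Lemma group_closedI A : A 1 -> (forall x y, A x -> A y -> A (x * y)) ->
  (forall x, A x -> A x^-1) -> group_closed (mem A).
Proof.
move=> A1 AM AV; split; first exact: mem_set.
by move=> x y /set_mem Ax /set_mem Ay; apply/mem_set/AM => //; apply: AV.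
Qed.

Lemma subgroup_ext S S' : S = S' :> set G -> S = S'.
Proof.
case: S S' => [A cA] [B cB] /= eqAB; case: _ / eqAB cB => cB.
by rewrite (Prop_irrelevance cA cB).
Qed.

Definition sg_full : subgroup G :=
  @Subgroup G setT (group_closedI I (fun _ _ _ _ => I) (fun _ _ => I)).

Fact generated_closed A :
  group_closed (mem (smallest (fun B : set G => group_closed (mem B)) A)).
Proof.
apply: group_closedI => [B [cB _]|x y Ax Ay B BA|x Ax B BA].
- exact: (sg1 (Subgroup cB)).
- exact: (@sgM (Subgroup BA.1) x y (Ax B BA) (Ay B BA)).
- exact: (@sgV (Subgroup BA.1) x (Ax B BA)).
Qed.

Definition generated A : subgroup G := Subgroup (generated_closed A).

Lemma sub_generated A : A `<=` generated A.
Proof. by move=> x Ax B [_]; apply. Qed.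

Lemma generated_min A S : A `<=` S -> generated A `<=` S.
Proof. by move=> AS x; apply; split=> //; exact: sgclosed. Qed.

(* [a, b] = a b a^-1 b^-1, whereas [~ a, b] is a^-1 b^-1 a b in MathComp. *)
Definition comm (a b : G) : G := a * b * a^-1 * b^-1.

Definition comm_sub (A B : set G) : subgroup G :=
  generated [set comm a b | a in A & b in B].

Lemma comm_in_sub (A B : set G) a b : A a -> B b -> comm_sub A B (comm a b).
Proof. by move=> Aa Bb; apply: sub_generated; exists a => //; exists b. Qed.

Lemma comm_sub_min (A B : set G) S :
  (forall a b, A a -> B b -> S (comm a b)) -> comm_sub A B `<=` S.
Proof. by move=> h; apply: generated_min => _ [a Aa [b Bb <-]]; apply: h. Qed.

Lemma comm_subS (A B B' : set G) : B `<=` B' -> comm_sub A B `<=` comm_sub A B'.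
Proof.
by move=> BB'; apply: comm_sub_min => a b Aa /BB' Bb; apply: comm_in_sub.
Qed.

Definition sgroup S := {x : G | x \in sgset S}.

HB.instance Definition _ S := SubChoice.on (sgroup S).
HB.instance Definition _ S :=
  SubChoice_isSubGroup.Build G (mem (sgset S)) (sgroup S) (sgclosed S).

Definition in_sgroup S x (Sx : S x) : sgroup S := SigSub (mem_set Sx).

Lemma sgroupP S (u : sgroup S) : S (val u).
Proof. exact/set_mem/(valP u). Qed.

End SubgroupTheory.

Notation "[ 'hom' K -> G ]" := (UMagmaMorphism.type K G)
  (at level 0, K at level 98, G at level 99, format "[ 'hom'  K  ->  G ]").

Section Preimage.
Variables (K G : groupType) (f : [hom K -> G]) (S : subgroup G).

Fact sg_preim_closed : group_closed (mem (f @^-1` S)).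
Proof.
apply: group_closedI => [|x y|x]; rewrite /preimage /=.
- by rewrite gmulf1; exact: sg1.
- by rewrite gmulfM; exact: sgM.
- by rewrite gmulfV; exact: sgV.
Qed.

Definition sg_preim : subgroup K := Subgroup sg_preim_closed.

End Preimage.

Record filtration (G : groupType) := Filtration {
  fterm :> nat -> subgroup G;
  fterm0 : fterm 0 = setT :> set G;
  ftermS : forall n, fterm n.+1 `<=` fterm n
}.

Section Filtrations.
Variable G : groupType.
Implicit Types F : filtration G.

Lemma in_fterm0 F x : F 0 x.
Proof. by rewrite fterm0. Qed.

Lemma fterm_le F m n : m <= n -> F n `<=` F m.
Proof.
move=> /subnKC <-; elim: (n - m) => [|k IH]; first by rewrite addn0.
by rewrite addnS => x /ftermS /IH.
Qed.

Lemma filtration_ext F F' : (forall n, F n = F' n :> set G) -> F = F'.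
Proof.
case: F F' => [t t0 tS] [t' t0' tS'] /= eqt.
have e : t = t' by apply/funext => n; apply: subgroup_ext.
case: _ / e t0' tS' eqt => t0' tS' _.
by rewrite (Prop_irrelevance t0 t0') (Prop_irrelevance tS tS').
Qed.

Definition fsub F F' := forall n, F n `<=` F' n.

Definition central F := forall n, comm_sub setT (F n) `<=` F n.+1.

Definition N_series F := forall m n, comm_sub (F m) (F n) `<=` F (m + n).+1.

Definition normal_terms F := forall n x y, F n y -> F n (x * y * x^-1).

(* Iterated commutators with the whole group; the lower central series when
   [S] is the whole group. *)
Definition gamma_from (S : subgroup G) (n : nat) : subgroup G :=
  iter n (fun T : subgroup G => comm_sub setT T) S.

Lemma gamma_from_decr (S : subgroup G) : gamma_from S 1 `<=` S ->
  forall n, gamma_from S n.+1 `<=` gamma_from S n.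
Proof. by move=> S1 n; elim: n => // n IH; exact: comm_subS. Qed.

Definition lcs : filtration G :=
  @Filtration G (gamma_from (sg_full G)) erefl
    (@gamma_from_decr (sg_full G) (fun _ _ => I)).

End Filtrations.

Section PreimageFiltration.
Variables (K G : groupType) (f : [hom K -> G]) (F : filtration G).

Fact fpreim0 : sg_preim f (F 0) = setT :> set K.
Proof. by rewrite /= fterm0 preimage_setT. Qed.

Fact fpreimS n : sg_preim f (F n.+1) `<=` sg_preim f (F n).
Proof. by move=> x; exact: ftermS. Qed.

Definition fpreim : filtration K :=
  @Filtration K (fun n => sg_preim f (F n)) fpreim0 fpreimS.

End PreimageFiltration.

(* The automorphism group of H, with (f * g) x = f (g x); the inverse map,
   determined by the automorphism, is part of the data. *)
Record aut (H : groupType) := Aut {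
  autf :> H -> H;
  autfV : H -> H;
  autfM : {morph autf : x y / x * y};
  autfK : cancel autf autfV;
  autfVK : cancel autfV autf
}.

Section AutGroup.
Variable H : groupType.
Implicit Types f g : aut H.

Lemma aut_ext f g : (forall x, f x = g x) -> f = g.
Proof.
case: f g => [f f' fM fK f'K] [g g' gM gK g'K] /= fg.
have e : f = g by apply/funext.
case: _ / e gM gK g'K fg => gM gK g'K _.
have e' : f' = g' by apply/funext => x; rewrite -{1}[x]g'K fK.
case: _ / e' gK g'K => gK g'K.
by rewrite (Prop_irrelevance fM gM) (Prop_irrelevance fK gK)
           (Prop_irrelevance f'K g'K).
Qed.

HB.instance Definition _ := gen_eqMixin (aut H).
HB.instance Definition _ := gen_choiceMixin (aut H).

Definition aut1 : aut H :=
  @Aut H id id (fun _ _ => erefl) (fun _ => erefl) (fun _ => erefl).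

Fact aut_mul_subproof f g : {morph f \o g : x y / x * y}.
Proof. by move=> x y /=; rewrite !autfM. Qed.

Definition aut_mul f g : aut H :=
  @Aut H (f \o g) (autfV g \o autfV f) (aut_mul_subproof f g)
    (can_comp (@autfK _ f) (@autfK _ g)) (can_comp (@autfVK _ g) (@autfVK _ f)).

Fact aut_inv_subproof f : {morph autfV f : x y / x * y}.
Proof. exact: can2_gmulfM (HB.pack (autf f) (isMultiplicative.Build H H f (@autfM _ f))) _ (@autfK _ f) (@autfVK _ f). Qed.

Definition aut_inv f : aut H :=
  @Aut H (autfV f) f (aut_inv_subproof f) (@autfVK _ f) (@autfK _ f).

Fact aut_mulA : associative aut_mul. Proof. by move=> f g h; apply: aut_ext. Qed.
Fact aut_mul1 : left_id aut1 aut_mul. Proof. by move=> f; apply: aut_ext. Qed.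
Fact aut_1mul : right_id aut1 aut_mul. Proof. by move=> f; apply: aut_ext. Qed.
Fact aut_mulV : left_inverse aut1 aut_inv aut_mul.
Proof. by move=> f; apply: aut_ext => x /=; rewrite autfK. Qed.
Fact aut_Vmul : right_inverse aut1 aut_inv aut_mul.
Proof. by move=> f; apply: aut_ext => x /=; rewrite autfVK. Qed.

HB.instance Definition _ :=
  isGroup.Build (aut H) aut_mulA aut_mul1 aut_1mul aut_mulV aut_Vmul.

End AutGroup.

Notation action K H := [hom K -> aut H].

Section Action.
Variables (K H : groupType) (phi : action K H).

Lemma act1 k : phi k 1 = 1.
Proof. by apply: (@mulgI _ (phi k 1)); rewrite -autfM !mulg1. Qed.

Lemma actM k x y : phi k (x * y) = phi k x * phi k y.
Proof. exact: autfM. Qed.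

Lemma actV k x : phi k x^-1 = (phi k x)^-1.
Proof. by apply/esym/mulg1_eq; rewrite -actM mulgV act1. Qed.

Lemma act_1 x : phi 1 x = x.
Proof. by rewrite gmulf1. Qed.

Lemma act_M k k' x : phi (k * k') x = phi k (phi k' x).
Proof. by rewrite gmulfM. Qed.

Lemma actK k : cancel (phi k) (phi k^-1).
Proof. by move=> x; rewrite -act_M mulVg act_1. Qed.

Lemma actKV k : cancel (phi k^-1) (phi k).
Proof. by move=> x; rewrite -act_M mulgV act_1. Qed.

(* The set A_{j+1}(K, H_* ). *)
Definition Aset (F : filtration H) (j : nat) : set K :=
  [set k | [/\ forall i h, F i h -> F i (phi k h),
               forall i h, F i h -> F i (phi k^-1 h)
             & forall i h, F i h -> F (i + j).+1 (phi k h * h^-1)]].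

Fact Aset_closed F j : group_closed (mem (Aset F j)).
Proof.
apply: group_closedI.
- split=> i h Fh; rewrite ?invg1 act_1 //.
  by rewrite mulgV; exact: sg1.
- move=> k k' [k1 k2 k3] [k1' k2' k3']; split=> i h Fh.
  + by rewrite act_M; apply/k1/k1'.
  + by rewrite invgM act_M; apply/k2'/k2.
  + rewrite act_M.
    have -> : phi k (phi k' h) * h^-1 = phi k (phi k' h * h^-1) * (phi k h * h^-1).
      by rewrite actM actV mulgA mulgVK.
    by apply: sgM; [apply/k1/k3'|apply: k3].
- move=> k [k1 k2 k3]; split; rewrite ?invgK // => i h Fh.
  have -> : phi k^-1 h * h^-1 = phi k^-1 (phi k h * h^-1)^-1.
    by rewrite invgM invgK actM actV actK.
  by apply/k2/sgV/k3.
Qed.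

Definition A_ F j : subgroup K := Subgroup (Aset_closed F j).

Lemma A_decr F j : A_ F j.+1 `<=` A_ F j.
Proof.
move=> k [k1 k2 k3]; split=> // i h Fh.
by apply: ftermS; rewrite -addnS; exact: k3.
Qed.

End Action.

(* A_*(K, H_* ) as a filtration on the group A_1(K, H_* ). *)
Section AFiltration.
Variables (K H : groupType) (phi : action K H) (F : filtration H).

Let A1 := sgroup (A_ phi F 0).

Definition A_term (n : nat) : subgroup A1 :=
  sg_preim (val : [hom A1 -> K]) (A_ phi F n).

Fact A_term0 : A_term 0 = setT :> set A1.
Proof. by apply/seteqP; split=> // u _; exact: sgroupP. Qed.

Fact A_termS n : A_term n.+1 `<=` A_term n.
Proof. by move=> u; exact: A_decr. Qed.

Definition A_filtration : filtration A1 := Filtration A_term0 A_termS.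

End AFiltration.

Definition aut_action (H : groupType) : action (aut H) H := idfun.

Definition acts (K H : groupType) (phi : action K H)
    (FK : filtration K) (FH : filtration H) :=
  forall j, FK j `<=` A_ phi FH j.

Definition semidirect (K H : groupType) (phi : action K H) : Type := (H * K)%type.

Section Semidirect.
Variables (K H : groupType) (phi : action K H).
Local Notation HK := (semidirect phi).

HB.instance Definition _ := Choice.copy HK (H * K)%type.

Definition sd_mul (x y : HK) : HK := (x.1 * phi x.2 y.1, x.2 * y.2).
Definition sd_one : HK := (1, 1).
Definition sd_inv (x : HK) : HK := (phi x.2^-1 x.1^-1, x.2^-1).

Fact sd_mulA : associative sd_mul.
Proof. by move=> x y z; rewrite /sd_mul /= actM act_M !mulgA. Qed.
Fact sd_mul1 : left_id sd_one sd_mul.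
Proof. by move=> [h k]; rewrite /sd_mul /= act_1 !mul1g. Qed.
Fact sd_1mul : right_id sd_one sd_mul.
Proof. by move=> [h k]; rewrite /sd_mul /= act1 !mulg1. Qed.
Fact sd_mulV : left_inverse sd_one sd_inv sd_mul.
Proof. by move=> [h k]; rewrite /sd_mul /sd_inv /= actV !mulVg. Qed.
Fact sd_Vmul : right_inverse sd_one sd_inv sd_mul.
Proof. by move=> [h k]; rewrite /sd_mul /sd_inv /= actKV !mulgV. Qed.

HB.instance Definition _ :=
  isGroup.Build HK sd_mulA sd_mul1 sd_1mul sd_mulV sd_Vmul.

Definition sd_inl (h : H) : HK := (h, 1).
Definition sd_inr (k : K) : HK := (1, k).

Fact sd_inl_morph : monoid.monoid_morphism sd_inl.
Proof.
split=> [//|x y]; change (sd_inl (x * y) = sd_mul (x, 1) (y, 1)).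
by rewrite /sd_mul /= act_1 mulg1.
Qed.
HB.instance Definition _ := isUMagmaMorphism.Build H HK sd_inl sd_inl_morph.

Fact sd_inr_morph : monoid.monoid_morphism sd_inr.
Proof.
split=> [//|x y]; change (sd_inr (x * y) = sd_mul (1, x) (1, y)).
by rewrite /sd_mul /= act1 mulg1.
Qed.
HB.instance Definition _ := isUMagmaMorphism.Build K HK sd_inr sd_inr_morph.

Section Terms.
Variables (FK : filtration K) (FH : filtration H) (hact : acts phi FK FH).

Definition sd_set (n : nat) : set HK := [set x | FH n x.1 /\ FK n x.2].

Fact sd_closed n : group_closed (mem (sd_set n)).
Proof.
apply: group_closedI => [|[h k] [h' k']|[h k]]; rewrite /sd_set /=.
- by split; exact: sg1.
- move=> [Fh Fk] [Fh' Fk']; split; last exact: sgM.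
  by apply: sgM => //; have [+ _ _] := hact Fk; apply.
- move=> [Fh Fk]; split; last exact: sgV.
  by have [_ + _] := hact Fk; apply; apply: sgV.
Qed.

Definition sd_term n : subgroup HK := Subgroup (sd_closed n).

Fact sd_term0 : sd_term 0 = setT :> set HK.
Proof. by apply/seteqP; split=> // x _; split; exact: in_fterm0. Qed.

Fact sd_termS n : sd_term n.+1 `<=` sd_term n.
Proof. by move=> x [? ?]; split; exact: ftermS. Qed.

Definition sd_filtration : filtration HK := Filtration sd_term0 sd_termS.

End Terms.

(* The filtration gamma_*^K(H).  The commutators are taken in the semidirect
   product, starting from the copy of H in it; all these subgroups lie in that
   copy, and are then read in H. *)
Fact sd_H_closed : group_closed (mem [set x : HK | x.2 = 1]).
Proof.
apply: group_closedI => [|[h k] [h' k'] /= -> ->|[h k] /= ->] //=.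
- by rewrite mulg1.
- by rewrite invg1.
Qed.

Definition sd_H : subgroup HK := Subgroup sd_H_closed.

Lemma gammaK_decr n : gamma_from sd_H n.+1 `<=` gamma_from sd_H n.
Proof.
apply: gamma_from_decr; apply: comm_sub_min => -[h k] [h' k'] _.
by move=> /= ->; rewrite mulg1 invg1 mulg1 mulgV.
Qed.

Fact gammaK0 : sg_preim (sd_inl : [hom H -> HK]) (gamma_from sd_H 0) = setT :> set H.
Proof. exact/seteqP. Qed.

Fact gammaKS n : sg_preim (sd_inl : [hom H -> HK]) (gamma_from sd_H n.+1)
  `<=` sg_preim (sd_inl : [hom H -> HK]) (gamma_from sd_H n).
Proof. by move=> h; exact: gammaK_decr. Qed.

Definition gammaK : filtration H := Filtration gammaK0 gammaKS.

End Semidirect.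

Definition filtration_property := forall G : groupType, filtration G -> Prop.

Section Properties.
Variables P Q : filtration_property.

Definition prop_implies := forall (G : groupType) (F : filtration G), P F -> Q F.

Section Envelope.
Variables (G : groupType) (F : filtration G).

Definition is_envelope (E : filtration G) :=
  [/\ P E, fsub F E & forall E', P E' -> fsub F E' -> fsub E E'].

(* The P-envelope of F, with junk value F when it does not exist. *)
Definition envelope : filtration G :=
  if pselect (exists E, is_envelope E) is left ex then projT1 (cid ex) else F.

Lemma envelopeP : (exists E, is_envelope E) -> is_envelope envelope.
Proof. by rewrite /envelope; case: pselect => // ex _; case: (cid ex). Qed.

Lemma is_envelope_unique E E' : is_envelope E -> is_envelope E' -> E = E'.
Proof.
move=> [PE FE minE] [PE' FE' minE']; apply: filtration_ext => n.
by apply/seteqP; split; [apply: minE|apply: minE'].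
Qed.

End Envelope.

Definition gammaP (G : groupType) : filtration G := envelope (lcs G).

Definition hyp_H0 := forall (K G : groupType) (f : [hom K -> G]) (F : filtration G),
  P F -> P (fpreim f F).

Definition hyp_H1 := forall (G : groupType) (F : filtration G),
  P F -> P (A_filtration (aut_action G) F).

Definition hyp_H2 := forall (K H : groupType) (phi : action K H)
    (FK : filtration K) (FH : filtration H) (hact : acts phi FK FH),
  P FK -> P FH -> P (sd_filtration hact).

(* The notation G_*^P rests on H3 and H4, which concern Q-filtrations only.
   Nothing here forces [gammaK phi] to satisfy Q, and H x| K need not be
   decomposed by its envelope when it does not.  Take for P the conditions
   [G, G] <= G_2, g^2 \in G_2 for all g, [G, G_2] <= G_3 = G_4 = ..., and for
   Q "P, or the lower central series".  All the hypotheses hold.  Let Z act on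
   H = Z^2 by k e_1 = e_1, k e_2 = e_1 + e_2.  Then gammaK is H, Z e_1, 0, ...,
   with P-envelope H, <e_1, 2 e_2>, 0, ..., but 2 e_1 = [k, 2 e_2] lies in the
   third term of every P-filtration on the semidirect product. *)
Definition hyp_H3 := forall (G : groupType) (F : filtration G),
  Q F -> exists E, is_envelope F E.

Definition hyp_H4 := forall (G : groupType) (F : filtration G),
  Q F -> forall j, A_ (aut_action G) F j `<=` A_ (aut_action G) (envelope F) j.

End Properties.

Section CommTheory.
Variable G : groupType.
Implicit Types x y z : G.

Lemma comm_Ml x y z : comm (x * y) z = comm x (comm y z) * comm y z * comm x z.
Proof. by rewrite /comm !(invgM, invgK, mulgA) !(mulgVK, mulgK). Qed.

Lemma comm_Mr x y z : comm x (y * z) = comm x y * comm y (comm x z) * comm x z.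
Proof. by rewrite /comm !(invgM, invgK, mulgA) !(mulgVK, mulgK). Qed.

Lemma commV x y : (comm x y)^-1 = comm y x.
Proof. by rewrite /comm !(invgM, invgK, mulgA). Qed.

Lemma comm_self x : comm x x = 1.
Proof. by rewrite /comm mulgK mulgV. Qed.

Lemma comm_Hall_Witt x y z :
  comm (comm x y) (y * z * y^-1) * comm (comm y z) (z * x * z^-1)
    * comm (comm z x) (x * y * x^-1) = 1.
Proof. by rewrite /comm !(invgM, invgK, mulgA) !(mulgVK, mulgK) mulgV. Qed.

Lemma conj_comm x y : x * y * x^-1 = comm x y * y.
Proof. by rewrite /comm mulgVK. Qed.

End CommTheory.

Lemma N_series_central (G : groupType) (F : filtration G) :
  N_series F -> central F.
Proof.
move=> NF n; apply: subset_trans (NF 0 n).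
by apply: comm_sub_min => x y _ Fy; apply: comm_in_sub Fy; exact: in_fterm0.
Qed.

Record central_filtration (G : groupType) := CentralFiltration {
  cfilt :> filtration G;
  cfiltP : central cfilt
}.

Record nseries (G : groupType) := NSeries {
  nfilt : filtration G;
  nfiltP : N_series nfilt
}.

Coercion nseries_central (G : groupType) (F : nseries G) :=
  CentralFiltration (N_series_central (@nfiltP G F)).

Section Graded.
Variables (G : groupType) (F : central_filtration G) (n : nat).
Implicit Types x y : G.

Definition gr_rel (x y : sgroup (F n)) : bool :=
  `[< F n.+1 (val x * (val y)^-1) >].

Fact gr_rel_refl : reflexive gr_rel.
Proof. by move=> x; apply/asboolP; rewrite mulgV; exact: sg1. Qed.

Fact gr_rel_sym : symmetric gr_rel.
Proof.
by move=> x y; apply/asboolP/asboolP => /sgV; rewrite invgM invgK.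
Qed.

Fact gr_rel_trans : transitive gr_rel.
Proof.
move=> y x z /asboolP xy /asboolP yz; apply/asboolP.
by have := sgM xy yz; rewrite mulgA mulgVK.
Qed.

Definition gr_equiv := EquivRel gr_rel gr_rel_refl gr_rel_sym gr_rel_trans.

(* The quotient G_{n+1} / G_{n+2}. *)
Definition gr : Type := {eq_quot gr_equiv}.

HB.instance Definition _ := Choice.on gr.

Definition cls x (Fx : F n x) : gr := \pi_({eq_quot gr_equiv}) (in_sgroup Fx).

Lemma cls_eqP x y (Fx : F n x) (Fy : F n y) :
  cls Fx = cls Fy <-> F n.+1 (x * y^-1).
Proof. by split=> [/eqmodP/asboolP|h]; last exact/eqmodP/asboolP. Qed.

Lemma cls_irr x y (Fx : F n x) (Fy : F n y) : x = y -> cls Fx = cls Fy.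
Proof. by move=> e; apply/cls_eqP; rewrite e mulgV; exact: sg1. Qed.

Definition gr_rep (u : gr) : G := val (repr (u : {eq_quot gr_equiv})).

Lemma gr_repP (u : gr) : F n (gr_rep u).
Proof. exact: sgroupP. Qed.

Lemma cls_rep (u : gr) : cls (gr_repP u) = u.
Proof.
rewrite -[RHS](@reprK _ {eq_quot gr_equiv}) /cls; congr \pi.
exact: val_inj.
Qed.

Lemma gr_ind (T : gr -> Prop) : (forall x (Fx : F n x), T (cls Fx)) -> forall u, T u.
Proof. by move=> h u; rewrite -(cls_rep u). Qed.

Definition gr0 : gr := cls (sg1 (F n)).
Definition gr_opp (u : gr) : gr := cls (sgV (gr_repP u)).
Definition gr_add (u v : gr) : gr := cls (sgM (gr_repP u) (gr_repP v)).

Lemma conj_in m x y : F m y -> F m (x * y * x^-1).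
Proof.
move=> Fy; rewrite conj_comm; apply: sgM => //.
by apply: ftermS; apply: cfiltP; apply: comm_in_sub.
Qed.

Lemma rep_clsP x (Fx : F n x) : F n.+1 (gr_rep (cls Fx) * x^-1).
Proof. by apply/(cls_eqP (gr_repP _) Fx); rewrite cls_rep. Qed.

Lemma gr_addE x y (Fx : F n x) (Fy : F n y) :
  gr_add (cls Fx) (cls Fy) = cls (sgM Fx Fy).
Proof.
apply/cls_eqP; set a := gr_rep _; set b := gr_rep _.
have -> : a * b * (x * y)^-1 = a * (b * y^-1) * a^-1 * (a * x^-1).
  by rewrite invgM !mulgA mulgVK.
by apply: sgM; [apply: conj_in|]; exact: rep_clsP.
Qed.

Lemma gr_oppE x (Fx : F n x) : gr_opp (cls Fx) = cls (sgV Fx).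
Proof.
apply/cls_eqP; rewrite invgK; set a := gr_rep _.
have -> : a^-1 * x = x^-1 * (a * x^-1)^-1 * x^-1^-1.
  by rewrite invgM !invgK !mulgA mulVg mul1g.
by apply/conj_in/sgV/rep_clsP.
Qed.

Fact gr_addA : associative gr_add.
Proof.
elim/gr_ind=> x Fx; elim/gr_ind=> y Fy; elim/gr_ind=> z Fz.
by rewrite !gr_addE; apply: cls_irr; rewrite mulgA.
Qed.

Fact gr_addC : commutative gr_add.
Proof.
elim/gr_ind=> x Fx; elim/gr_ind=> y Fy; rewrite !gr_addE; apply/cls_eqP.
by rewrite invgM mulgA; apply: cfiltP; apply: comm_in_sub.
Qed.

Fact gr_add0 : left_id gr0 gr_add.
Proof.
by elim/gr_ind=> x Fx; rewrite gr_addE; apply: cls_irr; rewrite mul1g.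
Qed.

Fact gr_addN : left_inverse gr0 gr_opp gr_add.
Proof.
by elim/gr_ind=> x Fx; rewrite gr_oppE gr_addE; apply: cls_irr; rewrite mulVg.
Qed.

HB.instance Definition _ :=
  GRing.isZmodule.Build gr gr_addA gr_addC gr_add0 gr_addN.

Lemma clsD x y (Fx : F n x) (Fy : F n y) :
  (cls Fx + cls Fy)%R = cls (sgM Fx Fy).
Proof. exact: gr_addE. Qed.

Lemma cls_opp x (Fx : F n x) (Fx' : F n x^-1) : cls Fx' = (- cls Fx)%R.
Proof. by rewrite [RHS]gr_oppE; exact: cls_irr. Qed.

Lemma cls_eq0 x (Fx : F n x) : F n.+1 x -> cls Fx = 0%R.
Proof. by move=> Fx1; apply/cls_eqP; rewrite invg1 mulg1. Qed.

Lemma cls_eq0P x (Fx : F n x) : cls Fx = 0%R <-> F n.+1 x.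
Proof.
split; last exact: cls_eq0.
by move/cls_eqP; rewrite invg1 mulg1.
Qed.

End Graded.

(* Graded Lie rings in degrees >= 1; [L n] is the component of degree n + 1.
   The bracket is given on homogeneous elements, with an explicit equation for
   the degree of the result, which avoids casts. *)
Record graded_lie := GradedLie {
  gl :> nat -> zmodType;
  brk : forall m n p, (m + n).+1 = p -> gl m -> gl n -> gl p;
  brkDl : forall m n p (e : (m + n).+1 = p) (x x' : gl m) (y : gl n),
    (brk e (x + x') y = brk e x y + brk e x' y)%R;
  brkDr : forall m n p (e : (m + n).+1 = p) (x : gl m) (y y' : gl n),
    (brk e x (y + y') = brk e x y + brk e x y')%R;
  brk_self : forall m p (e : (m + m).+1 = p) (x : gl m), (brk e x x = 0)%R;
  brk_anti : forall m n p (e : (m + n).+1 = p) (e' : (n + m).+1 = p)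
      (x : gl m) (y : gl n),
    (brk e x y = - brk e' y x)%R;
  brk_jacobi : forall m n q s t u p
      (e1 : (m + n).+1 = s) (f1 : (s + q).+1 = p)
      (e2 : (n + q).+1 = t) (f2 : (t + m).+1 = p)
      (e3 : (q + m).+1 = u) (f3 : (u + n).+1 = p)
      (x : gl m) (y : gl n) (z : gl q),
    (brk f1 (brk e1 x y) z + brk f2 (brk e2 y z) x
       + brk f3 (brk e3 z x) y = 0)%R
}.

Section GradedLieOfNSeries.
Variables (G : groupType) (F : nseries G).

Lemma comm_in m n p (e : (m + n).+1 = p) x y :
  F m x -> F n y -> F p (comm x y).
Proof. by move=> Fx Fy; rewrite -e; apply: nfiltP; apply: comm_in_sub. Qed.

Definition gr_brk m n p (e : (m + n).+1 = p) (u : gr F m) (v : gr F n) : gr F p :=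
  cls (comm_in e (gr_repP u) (gr_repP v)).

Lemma cls_comm_Ml m n p (e : (m + n).+1 = p) x x' y
    (Fx : F m x) (Fx' : F m x') (Fy : F n y) :
  cls (comm_in e (sgM Fx Fx') Fy)
  = (cls (comm_in e Fx Fy) + cls (comm_in e Fx' Fy))%R.
Proof.
rewrite addrC; have Fc : F p.+1 (comm x (comm x' y)).
  have lep : p < (m + p).+1 by rewrite ltnS leq_addl.
  exact: (fterm_le lep (comm_in erefl Fx (comm_in e Fx' Fy))).
rewrite [RHS]gr_addE; apply/cls_eqP.
by rewrite comm_Ml -(mulgA _ (comm x' y)) mulgK.
Qed.

Lemma cls_comm_anti m n p (e : (m + n).+1 = p) (e' : (n + m).+1 = p) x y
    (Fx : F m x) (Fy : F n y) :
  cls (comm_in e Fx Fy) = (- cls (comm_in e' Fy Fx))%R.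
Proof. by rewrite [RHS]gr_oppE; apply: cls_irr; rewrite commV. Qed.

Lemma cls_comm_Mr m n p (e : (m + n).+1 = p) x y y'
    (Fx : F m x) (Fy : F n y) (Fy' : F n y') :
  cls (comm_in e Fx (sgM Fy Fy'))
  = (cls (comm_in e Fx Fy) + cls (comm_in e Fx Fy'))%R.
Proof.
have e' : (n + m).+1 = p by rewrite addnC.
by rewrite !(cls_comm_anti e e') cls_comm_Ml opprD.
Qed.

Lemma cls_comm_eql m n p (e : (m + n).+1 = p) x x' y
    (Fx : F m x) (Fx' : F m x') (Fy : F n y) : F m.+1 (x * x'^-1) ->
  cls (comm_in e Fx Fy) = cls (comm_in e Fx' Fy).
Proof.
move=> Fd; have Fd' : F m (x * x'^-1) by exact: ftermS.
have -> : cls (comm_in e Fx Fy) = cls (comm_in e (sgM Fd' Fx') Fy).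
  by apply: cls_irr; rewrite mulgVK.
rewrite cls_comm_Ml cls_eq0 ?add0r //.
by apply: comm_in Fd Fy; rewrite addSn e.
Qed.

Lemma cls_comm_eqr m n p (e : (m + n).+1 = p) x y y'
    (Fx : F m x) (Fy : F n y) (Fy' : F n y') : F n.+1 (y * y'^-1) ->
  cls (comm_in e Fx Fy) = cls (comm_in e Fx Fy').
Proof.
have e' : (n + m).+1 = p by rewrite addnC.
by move=> Fd; rewrite !(cls_comm_anti e e') (cls_comm_eql _ _ Fy').
Qed.

Lemma gr_brkE m n p (e : (m + n).+1 = p) x y (Fx : F m x) (Fy : F n y) :
  gr_brk e (cls Fx) (cls Fy) = cls (comm_in e Fx Fy).
Proof.
rewrite /gr_brk (cls_comm_eql e _ Fx) ?(cls_comm_eqr e _ _ Fy) //;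
  exact: rep_clsP.
Qed.

Fact gr_brkDl m n p (e : (m + n).+1 = p) (x x' : gr F m) (y : gr F n) :
  (gr_brk e (x + x') y = gr_brk e x y + gr_brk e x' y)%R.
Proof.
elim/gr_ind: x => x Fx; elim/gr_ind: x' => x' Fx'; elim/gr_ind: y => y Fy.
by rewrite clsD !gr_brkE cls_comm_Ml.
Qed.

Fact gr_brkDr m n p (e : (m + n).+1 = p) (x : gr F m) (y y' : gr F n) :
  (gr_brk e x (y + y') = gr_brk e x y + gr_brk e x y')%R.
Proof.
elim/gr_ind: x => x Fx; elim/gr_ind: y => y Fy; elim/gr_ind: y' => y' Fy'.
by rewrite clsD !gr_brkE cls_comm_Mr.
Qed.

Fact gr_brk_self m p (e : (m + m).+1 = p) (x : gr F m) : gr_brk e x x = 0%R.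
Proof.
elim/gr_ind: x => x Fx; rewrite gr_brkE cls_eq0 // comm_self; exact: sg1.
Qed.

Fact gr_brk_anti m n p (e : (m + n).+1 = p) (e' : (n + m).+1 = p)
    (x : gr F m) (y : gr F n) : (gr_brk e x y = - gr_brk e' y x)%R.
Proof.
elim/gr_ind: x => x Fx; elim/gr_ind: y => y Fy.
by rewrite !gr_brkE (cls_comm_anti e e').
Qed.

Lemma cls_conj m x y (Fy : F m y) (Fc : F m (x * y * x^-1)) : cls Fc = cls Fy.
Proof.
apply/cls_eqP; rewrite -[_ * y^-1]/(comm x y).
by apply: (@comm_in 0 m _ erefl) => //; exact: in_fterm0.
Qed.

Fact gr_brk_jacobi m n q s t u p
    (e1 : (m + n).+1 = s) (f1 : (s + q).+1 = p)
    (e2 : (n + q).+1 = t) (f2 : (t + m).+1 = p)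
    (e3 : (q + m).+1 = u) (f3 : (u + n).+1 = p)
    (x : gr F m) (y : gr F n) (z : gr F q) :
  (gr_brk f1 (gr_brk e1 x y) z + gr_brk f2 (gr_brk e2 y z) x
     + gr_brk f3 (gr_brk e3 z x) y = 0)%R.
Proof.
elim/gr_ind: x => x Fx; elim/gr_ind: y => y Fy; elim/gr_ind: z => z Fz.
rewrite !(gr_brkE e1, gr_brkE e2, gr_brkE e3).
rewrite -(cls_conj Fz (conj_in y Fz)) -(cls_conj Fx (conj_in z Fx)).
rewrite -(cls_conj Fy (conj_in x Fy)) !gr_brkE.
rewrite !clsD.
apply: cls_eq0; rewrite comm_Hall_Witt; exact: sg1.
Qed.

End GradedLieOfNSeries.

Lemma additiveN (U V : zmodType) (f : U -> V) :
  {morph f : x y / (x + y)%R} -> {morph f : x / (- x)%R}.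
Proof.
move=> fD x; have f0 : f 0%R = 0%R.
  by apply: (@addrI _ (f 0%R)); rewrite -fD !addr0.
by apply: (@addrI _ (f x)); rewrite -fD !subrr.
Qed.

(* An action of M on L by derivations, compatible with the degrees. *)
Record graded_action (M L : graded_lie) := GradedAction {
  gact : forall m n p, (m + n).+1 = p -> M m -> L n -> L p;
  gactDl : forall m n p (e : (m + n).+1 = p) (k k' : M m) (h : L n),
    (gact e (k + k') h = gact e k h + gact e k' h)%R;
  gactDr : forall m n p (e : (m + n).+1 = p) (k : M m) (h h' : L n),
    (gact e k (h + h') = gact e k h + gact e k h')%R;
  gact_der : forall m n q s t u p
      (e1 : (n + q).+1 = s) (f1 : (m + s).+1 = p)
      (e2 : (m + n).+1 = t) (f2 : (t + q).+1 = p)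
      (e3 : (m + q).+1 = u) (f3 : (n + u).+1 = p)
      (k : M m) (h : L n) (h' : L q),
    (gact f1 k (brk e1 h h')
     = brk f2 (gact e2 k h) h' + brk f3 h (gact e3 k h'))%R;
  gact_brk : forall m n q s t u p
      (e1 : (m + n).+1 = s) (f1 : (s + q).+1 = p)
      (e2 : (n + q).+1 = t) (f2 : (m + t).+1 = p)
      (e3 : (m + q).+1 = u) (f3 : (n + u).+1 = p)
      (k : M m) (k' : M n) (h : L q),
    (gact f1 (brk e1 k k') h
     = gact f2 k (gact e2 k' h) - gact f3 k' (gact e3 k h))%R
}.

Definition gr_lie (G : groupType) (F : nseries G) : graded_lie :=
  @GradedLie (fun n => gr F n) (@gr_brk G F) (@gr_brkDl G F) (@gr_brkDr G F)
    (@gr_brk_self G F) (@gr_brk_anti G F) (@gr_brk_jacobi G F).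

Section SemidirectLie.
Variables (M L : graded_lie) (D : graded_action M L).
Local Open Scope ring_scope.

Definition deg_swap m n p (e : (m + n).+1 = p) : (n + m).+1 = p :=
  etrans (congr1 S (addnC n m)) e.

Definition sdl_carrier (n : nat) : zmodType := (L n * M n)%type.

Definition sdl_brk m n p (e : (m + n).+1 = p)
    (x : sdl_carrier m) (y : sdl_carrier n) : sdl_carrier p :=
  (brk e x.1 y.1 + gact D e x.2 y.1 - gact D (deg_swap e) y.2 x.1,
   brk e x.2 y.2).

Lemma brkN m n p (e : (m + n).+1 = p) (x : L m) (y : L n) :
  brk e (- x) y = - brk e x y.
Proof. by apply: (additiveN (f := fun x => brk e x y)) => ? ?; exact: brkDl. Qed.

Lemma gactN m n p (e : (m + n).+1 = p) (x : M m) (y : L n) :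
  gact D e x (- y) = - gact D e x y.
Proof. by apply: additiveN => ? ?; exact: gactDr. Qed.

Fact sdl_brkDl m n p (e : (m + n).+1 = p) (x x' : sdl_carrier m)
    (y : sdl_carrier n) :
  sdl_brk e (x + x') y = sdl_brk e x y + sdl_brk e x' y.
Proof.
congr pair; rewrite /= ?brkDl //= gactDl gactDr opprD.
by rewrite !addrA [LHS](ACl (1*3*5*2*4*6)).
Qed.

Fact sdl_brkDr m n p (e : (m + n).+1 = p) (x : sdl_carrier m)
    (y y' : sdl_carrier n) :
  sdl_brk e x (y + y') = sdl_brk e x y + sdl_brk e x y'.
Proof.
congr pair; rewrite /= ?brkDr //= gactDl gactDr opprD.
by rewrite !addrA [LHS](ACl (1*3*5*2*4*6)).
Qed.

Fact sdl_brk_self m p (e : (m + m).+1 = p) (x : sdl_carrier m) :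
  sdl_brk e x x = 0.
Proof.
congr pair; rewrite /= ?brk_self // add0r.
by rewrite (eq_irrelevance (deg_swap e) e) subrr.
Qed.

Fact sdl_brk_anti m n p (e : (m + n).+1 = p) (e' : (n + m).+1 = p)
    (x : sdl_carrier m) (y : sdl_carrier n) :
  sdl_brk e x y = - sdl_brk e' y x.
Proof.
congr pair; rewrite /= (brk_anti e e') // !opprD opprK.
rewrite (eq_irrelevance (deg_swap e) e') (eq_irrelevance (deg_swap e') e).
by rewrite addrAC.
Qed.

Fact sdl_jacobi_aux (V : zmodType)
    (j1 j2 j3 a123 a213 a312 a321 a231 a132 c1 c2 c3 c4 c5 c6 : V) :
  j1 + j2 + j3 = 0 ->
  (j1 + a123 - a213 + (c1 - c2) - (a312 - a321 + c3 - c4))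
  + (j2 + a231 - a321 + (c5 - c4) - (a123 - a132 + c1 - c6))
  + (j3 + a312 - a132 + (c3 - c6) - (a231 - a213 + c5 - c2)) = 0.
Proof.
move=> j0; rewrite !opprD !opprK !addrA.
rewrite [LHS](ACl (1*10*19*2*15*3*25*4*17*5*27*6*20*7*12*8*22*9*14*11*24*13*26*16*21*18*23)).
by rewrite /= !(addrK, subrK).
Qed.

Fact sdl_brk_jacobi m n q s t u p
    (e1 : (m + n).+1 = s) (f1 : (s + q).+1 = p)
    (e2 : (n + q).+1 = t) (f2 : (t + m).+1 = p)
    (e3 : (q + m).+1 = u) (f3 : (u + n).+1 = p)
    (x : sdl_carrier m) (y : sdl_carrier n) (z : sdl_carrier q) :
  sdl_brk f1 (sdl_brk e1 x y) z + sdl_brk f2 (sdl_brk e2 y z) x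
    + sdl_brk f3 (sdl_brk e3 z x) y = 0.
Proof.
congr pair; rewrite /=; last exact: brk_jacobi.
case: x y z => [h1 k1] [h2 k2] [h3 k3] /=.
have jac := brk_jacobi e1 f1 e2 f2 e3 f3 h1 h2 h3.
rewrite !brkDl !brkN !gactDr !gactN.
rewrite (gact_brk D e1 f1 e2 (deg_swap f2) (deg_swap e3) (deg_swap f3)).
rewrite (gact_brk D e2 f2 e3 (deg_swap f3) (deg_swap e1) (deg_swap f1)).
rewrite (gact_brk D e3 f3 e1 (deg_swap f1) (deg_swap e2) (deg_swap f2)).
rewrite (gact_der D e1 (deg_swap f1) e3 f3 (deg_swap e2) (deg_swap f2)).
rewrite (gact_der D e2 (deg_swap f2) e1 f1 (deg_swap e3) (deg_swap f3)).
rewrite (gact_der D e3 (deg_swap f3) e2 f2 (deg_swap e1) (deg_swap f1)).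
rewrite (brk_anti (deg_swap f1) f1) (brk_anti (deg_swap f2) f2).
rewrite (brk_anti (deg_swap f3) f3).
exact: sdl_jacobi_aux.
Qed.

Definition semidirect_lie : graded_lie :=
  GradedLie sdl_brkDl sdl_brkDr sdl_brk_self sdl_brk_anti sdl_brk_jacobi.

End SemidirectLie.

Section SemidirectNSeries.
Variables (K H : groupType) (phi : action K H).
Variables (FK : nseries K) (FH : nseries H) (hact : acts phi FK FH).

Local Notation HK := (semidirect phi).
Local Notation inl := (sd_inl phi).
Local Notation inr := (sd_inr phi).
Local Notation S := (sd_filtration hact).

Lemma act_in m n p (e : (m + n).+1 = p) k h :
  FK m k -> FH n h -> FH p (phi k h * h^-1).
Proof. by move=> Fk Fh; have [_ _] := hact Fk; rewrite -e addnC; apply. Qed.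

Lemma sd_mulE (x y : HK) : x * y = sd_mul x y.
Proof. by []. Qed.

Lemma sd_split (x : HK) : x = inl x.1 * inr x.2.
Proof. by case: x => h k; rewrite sd_mulE /sd_mul /= act1 mulg1 mul1g. Qed.

Lemma S_inl n h : FH n h -> S n (inl h).
Proof. by move=> Fh; split=> //; exact: sg1. Qed.

Lemma S_inr n k : FK n k -> S n (inr k).
Proof. by move=> Fk; split=> //; exact: sg1. Qed.

Lemma sd_conj k h : inr k * inl h * (inr k)^-1 = inl (phi k h).
Proof.
by rewrite -gmulfV !sd_mulE /sd_mul /= mul1g act1 !mulg1 mulgV.
Qed.

Lemma sd_comm k h : comm (inr k) (inl h) = inl (phi k h * h^-1).
Proof. by rewrite /comm sd_conj -gmulfV -gmulfM. Qed.

Lemma comm_hom (A B : groupType) (f : [hom A -> B]) x y :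
  f (comm x y) = comm (f x) (f y).
Proof. by rewrite /comm !(gmulfM, gmulfV). Qed.

Lemma S_conj n x y : S n y -> S n (x * y * x^-1).
Proof.
move=> Sy; rewrite [x]sd_split; set h := x.1; set k := x.2.
suff [cl cr] : (forall y, S n y -> S n (inl h * y * (inl h)^-1))
            /\ (forall y, S n y -> S n (inr k * y * (inr k)^-1)).
  have -> : inl h * inr k * y * (inl h * inr k)^-1
      = inl h * (inr k * y * (inr k)^-1) * (inl h)^-1.
    by rewrite invgM !mulgA.
  exact/cl/cr.
split=> {Sy}y [F1 F2]; rewrite [y]sd_split.
- have -> : inl h * (inl y.1 * inr y.2) * (inl h)^-1
      = inl (h * y.1 * h^-1) * comm (inl h) (inr y.2) * inr y.2.
    by rewrite /comm !gmulfM gmulfV !mulgA !mulgVK.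
  apply: sgM; last exact: S_inr.
  apply: sgM; first by apply: S_inl; exact: conj_in.
  rewrite -commV sd_comm; apply/sgV/S_inl.
  have le0 : n <= (n + 0).+1 by rewrite addn0.
  by apply: (fterm_le le0); apply: (act_in erefl) => //; exact: in_fterm0.
- have -> : inr k * (inl y.1 * inr y.2) * (inr k)^-1
      = inr k * inl y.1 * (inr k)^-1 * inr (k * y.2 * k^-1).
    by rewrite !gmulfM gmulfV !mulgA !mulgVK.
  rewrite sd_conj; apply: sgM; last by apply: S_inr; exact: conj_in.
  by apply: S_inl; have [+ _ _] := hact (in_fterm0 FK k); apply.
Qed.

Fact sd_N_series : N_series S.
Proof.
move=> m n; apply: comm_sub_min => x y [x1 x2] [y1 y2].
set p := (m + n).+1.
have Ml a b c : S p (comm a c) -> S p (comm b c) -> S p (comm (a * b) c).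
  move=> ac bc; rewrite comm_Ml; apply: sgM => //; apply: sgM => //.
  have -> : comm a (comm b c) = a * comm b c * a^-1 * (comm b c)^-1 by [].
  by apply: sgM; [exact: S_conj|exact: sgV].
have Mr a b c : S p (comm a b) -> S p (comm a c) -> S p (comm a (b * c)).
  by move=> ab ac; rewrite -commV; apply/sgV/Ml; rewrite -commV; apply: sgV.
rewrite [x]sd_split [y]sd_split; apply: Ml; apply: Mr.
- by rewrite -comm_hom; apply: S_inl; exact: comm_in.
- rewrite -commV sd_comm; apply/sgV/S_inl.
  by apply: act_in y2 x1; rewrite /p addnC.
- by rewrite sd_comm; apply/S_inl/(act_in erefl).
- by rewrite -comm_hom; apply: S_inr; exact: comm_in.
Qed.

Definition sd_nseries : nseries HK := NSeries sd_N_series.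

Definition gr_gact m n p (e : (m + n).+1 = p) (u : gr FK m) (v : gr FH n) :
    gr FH p :=
  cls (act_in e (gr_repP u) (gr_repP v)).

Let SN := sd_nseries.

Lemma cls_inl_inj n h h' (Fh : FH n h) (Fh' : FH n h')
    (Sh : SN n (inl h)) (Sh' : SN n (inl h')) :
  cls (F := SN) Sh = cls (F := SN) Sh' -> cls Fh = cls Fh'.
Proof. by move/cls_eqP; rewrite -gmulfV -gmulfM => -[? _]; apply/cls_eqP. Qed.

Lemma cls_inl_eq n h h' (Fh : FH n h) (Fh' : FH n h')
    (Sh : SN n (inl h)) (Sh' : SN n (inl h')) :
  cls Fh = cls Fh' -> cls (F := SN) Sh = cls (F := SN) Sh'.
Proof.
by move=> /cls_eqP F1; apply/cls_eqP; rewrite -gmulfV -gmulfM; apply: S_inl.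
Qed.

Lemma cls_inr_eq n k k' (Fk : FK n k) (Fk' : FK n k')
    (Sk : SN n (inr k)) (Sk' : SN n (inr k')) :
  cls Fk = cls Fk' -> cls (F := SN) Sk = cls (F := SN) Sk'.
Proof.
by move=> /cls_eqP F1; apply/cls_eqP; rewrite -gmulfV -gmulfM; apply: S_inr.
Qed.

Definition gr_inl n (v : gr FH n) : gr SN n := cls (F := SN) (S_inl (gr_repP v)).
Definition gr_inr n (u : gr FK n) : gr SN n := cls (F := SN) (S_inr (gr_repP u)).

Lemma gr_inlE n h (Fh : FH n h) : gr_inl (cls Fh) = cls (F := SN) (S_inl Fh).
Proof. exact: (cls_inl_eq _ _ (cls_rep (cls Fh))). Qed.

Lemma gr_inrE n k (Fk : FK n k) : gr_inr (cls Fk) = cls (F := SN) (S_inr Fk).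
Proof. exact: (cls_inr_eq _ _ (cls_rep (cls Fk))). Qed.

Lemma gr_inl_inj n : injective (@gr_inl n).
Proof.
elim/gr_ind=> x Fx; elim/gr_ind=> y Fy; rewrite !gr_inlE.
exact: cls_inl_inj.
Qed.

Lemma gr_inlD n (u v : gr FH n) : gr_inl (u + v)%R = (gr_inl u + gr_inl v)%R.
Proof.
elim/gr_ind: u => x Fx; elim/gr_ind: v => y Fy.
by rewrite clsD !gr_inlE clsD; apply: cls_irr; rewrite gmulfM.
Qed.

Lemma gr_inrD n (u v : gr FK n) : gr_inr (u + v)%R = (gr_inr u + gr_inr v)%R.
Proof.
elim/gr_ind: u => x Fx; elim/gr_ind: v => y Fy.
by rewrite clsD !gr_inrE clsD; apply: cls_irr; rewrite gmulfM.
Qed.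

Lemma gr_inlN n (u : gr FH n) : gr_inl (- u)%R = (- gr_inl u)%R.
Proof. by apply: additiveN => ? ?; exact: gr_inlD. Qed.

Lemma gr_inl_brk m n p (e : (m + n).+1 = p) (u : gr FH m) (v : gr FH n) :
  gr_inl (gr_brk e u v) = gr_brk e (gr_inl u) (gr_inl v).
Proof.
elim/gr_ind: u => x Fx; elim/gr_ind: v => y Fy.
by rewrite gr_brkE !gr_inlE gr_brkE; apply: cls_irr; rewrite comm_hom.
Qed.

Lemma gr_inr_brk m n p (e : (m + n).+1 = p) (u : gr FK m) (v : gr FK n) :
  gr_inr (gr_brk e u v) = gr_brk e (gr_inr u) (gr_inr v).
Proof.
elim/gr_ind: u => x Fx; elim/gr_ind: v => y Fy.
by rewrite gr_brkE !gr_inrE gr_brkE; apply: cls_irr; rewrite comm_hom.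
Qed.

Lemma gr_inl_gact m n p (e : (m + n).+1 = p) (u : gr FK m) (v : gr FH n) :
  gr_inl (gr_gact e u v) = gr_brk e (gr_inr u) (gr_inl v).
Proof.
rewrite /gr_inr /gr_inl gr_brkE -[LHS]/(gr_inl _) gr_inlE.
by apply: cls_irr; rewrite sd_comm.
Qed.

Lemma gr_gactE m n p (e : (m + n).+1 = p) k h (Fk : FK m k) (Fh : FH n h) :
  gr_gact e (cls Fk) (cls Fh) = cls (act_in e Fk Fh).
Proof.
apply: gr_inl_inj; rewrite gr_inl_gact gr_inrE !gr_inlE gr_brkE.
by apply: cls_irr; rewrite sd_comm.
Qed.

Fact gr_gactDl m n p (e : (m + n).+1 = p) (k k' : gr FK m) (h : gr FH n) :
  (gr_gact e (k + k') h = gr_gact e k h + gr_gact e k' h)%R.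
Proof.
by apply: gr_inl_inj; rewrite gr_inlD !gr_inl_gact gr_inrD gr_brkDl.
Qed.

Fact gr_gactDr m n p (e : (m + n).+1 = p) (k : gr FK m) (h h' : gr FH n) :
  (gr_gact e k (h + h') = gr_gact e k h + gr_gact e k h')%R.
Proof.
by apply: gr_inl_inj; rewrite gr_inlD !gr_inl_gact gr_inlD gr_brkDr.
Qed.

Lemma gr_brkNr a b c (e : (a + b).+1 = c) (x : gr SN a) (y : gr SN b) :
  (gr_brk e x (- y) = - gr_brk e x y)%R.
Proof. by apply: additiveN => ? ?; exact: gr_brkDr. Qed.

Fact gr_gact_der m n q s t u p
    (e1 : (n + q).+1 = s) (f1 : (m + s).+1 = p)
    (e2 : (m + n).+1 = t) (f2 : (t + q).+1 = p)
    (e3 : (m + q).+1 = u) (f3 : (n + u).+1 = p)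
    (k : gr FK m) (h : gr FH n) (h' : gr FH q) :
  (gr_gact f1 k (gr_brk e1 h h')
   = gr_brk f2 (gr_gact e2 k h) h' + gr_brk f3 h (gr_gact e3 k h'))%R.
Proof.
apply: gr_inl_inj; rewrite gr_inlD !(gr_inl_gact, gr_inl_brk).
have := gr_brk_jacobi e2 f2 e1 (deg_swap f1) (deg_swap e3) (deg_swap f3)
  (gr_inr k) (gr_inl h) (gr_inl h').
rewrite (gr_brk_anti (deg_swap f1) f1) (gr_brk_anti (deg_swap f3) f3).
rewrite (gr_brk_anti (deg_swap e3) e3) => /eqP.
rewrite addrAC subr_eq add0r => /eqP <-; congr (_ + _)%R.
by rewrite gr_brkNr opprK.
Qed.

Fact gr_gact_brk m n q s t u p
    (e1 : (m + n).+1 = s) (f1 : (s + q).+1 = p)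
    (e2 : (n + q).+1 = t) (f2 : (m + t).+1 = p)
    (e3 : (m + q).+1 = u) (f3 : (n + u).+1 = p)
    (k : gr FK m) (k' : gr FK n) (h : gr FH q) :
  (gr_gact f1 (gr_brk e1 k k') h
   = gr_gact f2 k (gr_gact e2 k' h) - gr_gact f3 k' (gr_gact e3 k h))%R.
Proof.
apply: gr_inl_inj; rewrite gr_inlD gr_inlN !(gr_inl_gact, gr_inr_brk).
have := gr_brk_jacobi e1 f1 e2 (deg_swap f2) (deg_swap e3) (deg_swap f3)
  (gr_inr k) (gr_inr k') (gr_inl h).
rewrite (gr_brk_anti (deg_swap f2) f2) (gr_brk_anti (deg_swap f3) f3).
rewrite (gr_brk_anti (deg_swap e3) e3) gr_brkNr opprK => /eqP.
by rewrite -addrA addr_eq0 opprD opprK => /eqP.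
Qed.

Definition gr_action : graded_action (gr_lie FK) (gr_lie FH) :=
  @GradedAction (gr_lie FK) (gr_lie FH) gr_gact gr_gactDl gr_gactDr
    gr_gact_der gr_gact_brk.

End SemidirectNSeries.

Definition graded_lie_iso (L M : graded_lie) (f : forall n, L n -> M n) :=
  [/\ forall n, bijective (f n),
      forall n, {morph f n : x y / (x + y)%R}
    & forall m n p (e : (m + n).+1 = p) (x : L m) (y : L n),
        f p (brk e x y) = brk e (f m x) (f n y)].

Section GroupActionOnGraded.
Variables (K H : groupType) (phi : action K H) (F : central_filtration H).

(* The action of K on the gr(F) of an F with stable terms. *)
Definition stable := forall k n h, F n h -> F n (phi k h).

Hypothesis st : stable.

Definition gr_act (k : K) n (u : gr F n) : gr F n := cls (st k (gr_repP u)).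

Lemma gr_actE k n h (Fh : F n h) : gr_act k (cls Fh) = cls (st k Fh).
Proof.
by apply/cls_eqP; rewrite -actV -actM; apply/st/rep_clsP.
Qed.

Definition gr_act_trivial := forall k n (u : gr F n), gr_act k u = u.

End GroupActionOnGraded.

(* Main.v *)
Require Import Defs.
From mathcomp Require Import all_boot.
From HB Require Import structures.
From mathcomp Require Import all_algebra boolp classical_sets.

(** Everything follows from one principle.  Since a P-filtration is central, it
    contains the lower central series; hence [gammaP P G] is the smallest
    P-filtration on G, and its terms are preserved by all group morphisms
    because (H0) lets one pull P-filtrations back.

    Suppose that K acts on H, that F is a P-filtration on H, and that all of K
    lies in A_1(K, F).  By (H1) and (H0), the filtration A_*(K, F), which is
    the pull-back of A_*(F) along K -> Aut(H), is a P-filtration on K.  So it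
    contains [gammaP P K]: an action that is trivial on the quotients
    F_i / F_{i+1} automatically is an action of the filtration [gammaP P K] on
    F ([gammaP_acts]).

    For (1), this is applied to G acting by conjugation on [gammaP P G]: that
    conjugation lies in A_1 is centrality, and the conclusion is precisely that
    [gammaP P G] is an N-series.

    For (2) and (3), let F be a P-filtration on H such that K lies in A_1(K, F)
    and such that F is contained in the restriction of [gammaP P (H x| K)] to
    H.  Then (H2) makes F x| [gammaP P K] a P-filtration, which therefore
    contains [gammaP P (H x| K)], while the opposite inclusion may be checked
    on H and on K separately ([gammaP_semidirect]).  In (2), F is the envelope
    of [gammaK], a Q-filtration, and (H4) is what carries the action of K over
    from [gammaK] to its envelope.  In (3), F is [gammaP P H], and the triviality of K on the
    graded ring says that K lies in A_1(K, F); as F x| [gammaP P K] is central,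
    F contains [gammaK], hence is its envelope.

    The isomorphism of Lie rings then is the one that exists for every
    semidirect product of N-series: (h, k) |-> h + k, whose compatibility with
    the brackets amounts to [k, h] = (k . h) h^-1 in H x| K. *)

Set Implicit Arguments.
Unset Strict Implicit.
Unset Printing Implicit Defensive.

Import GRing.Theory.
Local Open Scope classical_set_scope.
Local Open Scope group_scope.

(** * Actions on filtrations *)

Section ActionsOnFiltrations.
Variables (K H : groupType) (phi : action K H) (F : filtration H).

Lemma A_aut j k : A_ phi F j k <-> A_ (aut_action H) F j (phi k).
Proof. by rewrite /A_ /Aset /= /aut_action /= gmulfV. Qed.

(** The terms of F are preserved because k . h = ((k . h) h^-1) h; asking for
    all k at once covers k^-1 as well. *)
Lemma A1_commutators :
  (forall k n h, F n h -> F n.+1 (phi k h * h^-1)) -> forall k, A_ phi F 0 k.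
Proof.
move=> Fc; have Fst k n h : F n h -> F n (phi k h).
  move=> Fh; rewrite -[phi k h](mulgVK h); apply: sgM => //.
  by apply: ftermS; exact: Fc.
by move=> k; split=> i h Fh; rewrite ?addn0; [exact: Fst|exact: Fst|exact: Fc].
Qed.

Section Corestriction.
Hypothesis A1 : forall k, A_ phi F 0 k.

(** The action with its values in the group that carries the filtration
    A_*(F), so that this filtration can be pulled back to K. *)
Definition to_A1 (k : K) : sgroup (A_ (aut_action H) F 0) :=
  in_sgroup ((A_aut 0 k).1 (A1 k)).

Fact to_A1_morph : monoid.monoid_morphism to_A1.
Proof.
split=> [|x y]; apply: val_inj => /=; first by rewrite gmulf1.
by rewrite gmulfM.
Qed.

HB.instance Definition _ := isUMagmaMorphism.Build K _ to_A1 to_A1_morph.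

End Corestriction.

Fact aut_morph (f : aut H) : monoid.monoid_morphism (autf f).
Proof. by split; [exact: (act1 (aut_action H) f)|exact: autfM]. Qed.

HB.instance Definition _ (f : aut H) :=
  isUMagmaMorphism.Build H H (autf f) (aut_morph f).

End ActionsOnFiltrations.

Section Conjugation.
Variable G : groupType.

Fact conj_autM (g : G) : {morph (fun x => g * x * g^-1) : x y / x * y}.
Proof. by move=> x y; rewrite !mulgA mulgVK. Qed.

Fact conj_autK (g : G) :
  cancel (fun x => g * x * g^-1) (fun x => g^-1 * x * g).
Proof. by move=> x; rewrite !mulgA mulVg mul1g mulgVK. Qed.

Fact conj_autVK (g : G) :
  cancel (fun x => g^-1 * x * g) (fun x => g * x * g^-1).
Proof. by move=> x; rewrite !mulgA mulgV mul1g mulgK. Qed.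

Definition conj_aut (g : G) : aut G :=
  Aut (conj_autM g) (conj_autK g) (conj_autVK g).

Fact conj_aut_morph : monoid.monoid_morphism conj_aut.
Proof.
split=> [|x y]; apply: aut_ext => z /=; first by rewrite invg1 mulg1 mul1g.
by rewrite invgM !mulgA.
Qed.

HB.instance Definition _ := isUMagmaMorphism.Build G _ conj_aut conj_aut_morph.

End Conjugation.

(** * Semidirect products and the filtration [gammaK] *)

Section LowerCentralSeries.

Lemma gamma_from_subset (G : groupType) (S T : subgroup G) n :
  S `<=` T -> gamma_from S n `<=` gamma_from T n.
Proof. by move=> ST; elim: n => [//|n IH]; exact: comm_subS. Qed.

Lemma lcs_sub_central (G : groupType) (F : filtration G) :
  central F -> fsub (lcs G) F.
Proof.
move=> Fc; elim=> [|n IH]; first by move=> x _; exact: in_fterm0.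
by apply: subset_trans (Fc n); exact: comm_subS.
Qed.

Variables (K H : groupType) (phi : action K H).

Lemma gammaK_commutator k n h :
  gammaK phi n h -> gammaK phi n.+1 (phi k h * h^-1).
Proof.
move=> Fh; have := @comm_in_sub _ setT _ (sd_inr phi k) _ I Fh.
by rewrite sd_comm.
Qed.

(** [gammaK] is obtained by commutators with H x| K as the lower central series
    of H x| K is, but starting from H only. *)
Lemma gammaK_sub (F : filtration (semidirect phi)) :
  central F -> fsub (gammaK phi) (fpreim (sd_inl phi) F).
Proof.
move=> /lcs_sub_central Fc n h Fh; apply: Fc.
exact: (@gamma_from_subset _ (sd_H phi) (sg_full _) n).
Qed.

End LowerCentralSeries.

(** * The smallest P-filtration *)

Section SmallestFiltration.
Variable P : filtration_property.
Hypothesis Pcentral : forall (G : groupType) (F : filtration G), P F -> central F.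
Hypotheses (h0 : hyp_H0 P) (h1 : hyp_H1 P).
Hypothesis lcs_env : forall G : groupType, exists E, is_envelope P (lcs G) E.

Lemma gammaP_P (G : groupType) : P (gammaP P G).
Proof. by have [] := envelopeP (lcs_env G). Qed.

Lemma gammaP_min (G : groupType) (F : filtration G) :
  P F -> fsub (gammaP P G) F.
Proof.
move=> PF; have [_ _] := envelopeP (lcs_env G).
by apply=> //; apply/lcs_sub_central/Pcentral.
Qed.

Lemma gammaP_hom (K G : groupType) (f : [hom K -> G]) n x :
  gammaP P K n x -> gammaP P G n (f x).
Proof. exact/(@gammaP_min _ (fpreim f (gammaP P G)))/h0/gammaP_P. Qed.

(** The pull-back of A_*(F) along K -> Aut(H) is a P-filtration on K, and
    its terms are the A_j(K, F). *)
Lemma gammaP_acts (K H : groupType) (phi : action K H) (F : filtration H) :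
  P F -> (forall k, A_ phi F 0 k) -> acts phi (gammaP P K) F.
Proof.
move=> PF A1 j k Fk; apply/A_aut.
exact: (gammaP_min (h0 (to_A1 A1) (h1 PF)) Fk).
Qed.

(** For G acting on normal subgroups by conjugation, A_j consists of the g such
    that [g, -] raises the degree by j. *)
Lemma gammaP_N_series (G : groupType) : N_series (gammaP P G).
Proof.
have A1 g : A_ (@conj_aut G) (gammaP P G) 0 g.
  apply: A1_commutators => k n h Fh.
  by apply: (Pcentral (gammaP_P G)); exact: comm_in_sub.
move=> m n; apply: comm_sub_min => x y Fx Fy.
by have [_ _] := gammaP_acts (gammaP_P G) A1 Fx; rewrite addnC; apply.
Qed.

Section Semidirect.
Hypothesis h2 : hyp_H2 P.
Variables (K H : groupType) (phi : action K H).

Lemma gammaP_semidirect (F : filtration H)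
    (hact : acts phi (gammaP P K) F) :
    P F -> fsub F (fpreim (sd_inl phi) (gammaP P (semidirect phi))) ->
  gammaP P (semidirect phi) = sd_filtration hact.
Proof.
move=> PF F_sub; apply: filtration_ext => n; apply/seteqP; split.
  by apply: gammaP_min; apply: h2 => //; exact: gammaP_P.
move=> x [Fh Fk]; rewrite (sd_split x); apply: sgM; first exact: F_sub.
exact: (gammaP_hom (sd_inr phi)).
Qed.

(** Centrality of F x| [gammaP P K], for F = [gammaP P H], bounds [gammaK]
    by F. *)
Lemma gammaK_envelope :
    (forall k, A_ phi (gammaP P H) 0 k) ->
  is_envelope P (gammaK phi) (gammaP P H).
Proof.
move=> /(gammaP_acts (gammaP_P H)) hact.
have PS := h2 hact (gammaP_P K) (gammaP_P H).
split; first exact: gammaP_P.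
- by move=> n h /(gammaK_sub (Pcentral PS)) [].
- by move=> E PE _; exact: gammaP_min.
Qed.

End Semidirect.
End SmallestFiltration.

(** * The graded Lie ring of a semidirect product *)

Section GradedSemidirect.
Variables (K H : groupType) (phi : action K H).
Variables (FK : nseries K) (FH : nseries H) (hact : acts phi FK FH).
Local Notation S := (sd_nseries hact).

Definition gr_of_pair n (x : semidirect_lie (gr_action hact) n) : gr S n :=
  (gr_inl hact x.1 + gr_inr hact x.2)%R.

Definition gr_to_pair n (u : gr S n) : semidirect_lie (gr_action hact) n :=
  (cls (gr_repP u).1, cls (gr_repP u).2).

Lemma gr_of_pairE n h k (Fh : FH n h) (Fk : FK n k)
    (Fhk : S n ((h, k) : semidirect phi)) :
  gr_of_pair (cls Fh, cls Fk) = cls Fhk.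
Proof.
rewrite /gr_of_pair /= gr_inlE gr_inrE clsD; apply: cls_irr.
exact/esym/(sd_split ((h, k) : semidirect phi)).
Qed.

Lemma gr_to_pairE n h k (Fh : FH n h) (Fk : FK n k)
    (Fhk : S n ((h, k) : semidirect phi)) :
  gr_to_pair (cls Fhk) = (cls Fh, cls Fk).
Proof.
have [Eh Ek] := rep_clsP Fhk; rewrite /gr_to_pair.
congr pair; apply/cls_eqP; last exact: Ek.
set r := gr_rep _ in Eh Ek *.
(* The H-component of r (h, k)^-1 is r.1 (d . h^-1) with d = r.2 k^-1, and
   d . h = h modulo FH n.+1. *)
have -> : r.1 * h^-1 = r.1 * phi r.2 (phi k^-1 h^-1)
                       * (phi (r.2 * k^-1) h * h^-1).
  by rewrite -act_M actV !mulgA mulgVK.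
apply: sgM; first exact: Eh.
have le_n : n.+1 <= (0 + n).+1 by rewrite add0n.
by apply: (fterm_le le_n); apply: (act_in hact erefl) => //; exact: in_fterm0.
Qed.

Lemma gr_to_pairK n : cancel (@gr_to_pair n) (@gr_of_pair n).
Proof.
elim/gr_ind=> -[h k] Fhk; have [Fh Fk] := Fhk.
by rewrite (gr_to_pairE Fh Fk Fhk) (gr_of_pairE Fh Fk Fhk).
Qed.

Lemma gr_of_pairK n : cancel (@gr_of_pair n) (@gr_to_pair n).
Proof.
case=> u v; elim/gr_ind: u => h Fh; elim/gr_ind: v => k Fk.
have Fhk : S n ((h, k) : semidirect phi) by [].
by rewrite (gr_of_pairE Fh Fk Fhk) (gr_to_pairE Fh Fk Fhk).
Qed.

Lemma gr_of_pairD n : {morph @gr_of_pair n : x y / (x + y)%R}.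
Proof.
by move=> x y; rewrite /gr_of_pair /= gr_inlD gr_inrD addrACA.
Qed.

(** The action of gr(FK) on gr(FH) is the bracket of gr(S), so the formula that
    defines the bracket of pairs is the bilinear expansion of
    [h + k, h' + k']. *)
Lemma gr_of_pair_brk m n p (e : (m + n).+1 = p)
    (x : semidirect_lie (gr_action hact) m)
    (y : semidirect_lie (gr_action hact) n) :
  gr_of_pair (brk e x y) = gr_brk e (gr_of_pair x) (gr_of_pair y).
Proof.
rewrite /gr_of_pair /= gr_brkDl !gr_brkDr.
rewrite !gr_inlD gr_inlN !gr_inl_gact gr_inl_brk gr_inr_brk.
rewrite (gr_brk_anti e (deg_swap e) (gr_inl hact x.1) (gr_inr hact y.2)).
by rewrite !addrA [LHS](AC 4 (1*3*2*4))%AC.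
Qed.

Lemma gr_to_pair_iso :
  graded_lie_iso (L := gr_lie S) (M := semidirect_lie (gr_action hact))
    gr_to_pair.
Proof.
split=> [n|n|m n p e x y].
- by exists (@gr_of_pair n); [exact: gr_to_pairK|exact: gr_of_pairK].
- move=> x y; apply: (can_inj (@gr_of_pairK n)).
  by rewrite gr_of_pairD !gr_to_pairK.
- apply: (can_inj (@gr_of_pairK p)).
  by rewrite gr_of_pair_brk !gr_to_pairK.
Qed.

End GradedSemidirect.

(** Only the filtration underlying S is compared with the semidirect product:
    two N-series with the same filtration differ by a mere proof, and it is the
    filtrations that minimality identifies. *)
Lemma semidirect_gr_iso (K H : groupType) (phi : action K H)
    (FK : nseries K) (FH : nseries H) (hact : acts phi FK FH)
    (S : nseries (semidirect phi)) :
  nfilt S = sd_filtration hact ->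
  exists f : forall n, gr_lie S n -> semidirect_lie (gr_action hact) n,
    graded_lie_iso f /\
    forall n (h : H) (k : K) (Fh : FH n h) (Fk : FK n k)
        (Fhk : S n ((h, k) : semidirect phi)),
      f n (cls Fhk) = (cls Fh, cls Fk).
Proof.
case: S => F NF /= eF; move: NF; rewrite eF => NF.
rewrite (Prop_irrelevance NF (@sd_N_series _ _ _ FK FH hact)).
exists (@gr_to_pair _ _ _ FK FH hact); split; first exact: gr_to_pair_iso.
exact: gr_to_pairE.
Qed.

(** * Decomposition for P-filtrations *)

Theorem theorem2p19 (P Q : filtration_property)
    (PQ : prop_implies P Q)
    (Qnormal : forall (G : groupType) (F : filtration G), Q G F -> normal_terms F)
    (Qlcs : forall G : groupType, Q G (lcs G))
    (Pcentral : forall (G : groupType) (F : filtration G), P G F -> central F)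
    (h0 : hyp_H0 P) (h1 : hyp_H1 P) (h2 : hyp_H2 P)
    (h3 : hyp_H3 P Q) (h4 : hyp_H4 P Q) :
  exists hN : forall G : groupType, N_series (gammaP P G),
  let gammaPN (G : groupType) : nseries G := NSeries (hN G) in
  forall (K H : groupType) (phi : action K H),
    (Q H (gammaK phi) ->
      exists hact : acts phi (gammaP P K) (envelope P (gammaK phi)),
        gammaP P (semidirect phi) = sd_filtration hact) /\
    exists st : stable phi (gammaPN H),
      gr_act_trivial st ->
      envelope P (gammaK phi) = gammaP P H /\
      exists (hact : acts phi (gammaPN K) (gammaPN H))
          (f : forall n, gr_lie (gammaPN (semidirect phi)) n ->
                         semidirect_lie (gr_action hact) n),
        graded_lie_iso f /\
        forall n (h : H) (k : K) (Fh : gammaPN H n h) (Fk : gammaPN K n k)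
            (Fhk : gammaPN (semidirect phi) n ((h, k) : semidirect phi)),
          f n (cls Fhk) = (cls Fh, cls Fk).
Proof.
have envl G := h3 _ _ (Qlcs G).
exists (gammaP_N_series Pcentral h0 h1 envl) => gammaPN K H phi; split.
  move=> QK; have [PE KE minE] := envelopeP (h3 _ _ QK).
  have A1 k : A_ phi (envelope P (gammaK phi)) 0 k.
    apply/A_aut; apply: (h4 _ _ QK); apply/(A_aut phi).
    by apply: A1_commutators => {}k n h; exact: gammaK_commutator.
  have hact := gammaP_acts Pcentral h0 h1 envl PE A1.
  exists hact; apply: (gammaP_semidirect Pcentral h0 envl h2) => //.
  have PG := gammaP_P envl (semidirect phi).
  by apply: minE; [exact: (h0 _ _ _ _ PG)|exact/gammaK_sub/Pcentral].
have st : stable phi (gammaPN H).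
  by move=> k n h; exact: (gammaP_hom Pcentral h0 envl (phi k)).
exists st => triv.
have A1 k : A_ phi (gammaP P H) 0 k.
  apply: A1_commutators => {}k n h Fh.
  by have := triv k n (cls (F := gammaPN H) Fh); rewrite gr_actE => /cls_eqP.
have envK := gammaK_envelope Pcentral h0 h1 envl h2 A1.
split.
  apply: is_envelope_unique (envK); apply: envelopeP.
  by exists (gammaP P H); exact: envK.
have hact : acts phi (gammaPN K) (gammaPN H).
  exact: (gammaP_acts Pcentral h0 h1 envl (gammaP_P envl H) A1).
exists hact; apply: semidirect_gr_iso.
apply: (gammaP_semidirect Pcentral h0 envl h2); first exact: gammaP_P.
by move=> n h; exact: (gammaP_hom Pcentral h0 envl (sd_inl phi)).
Qed.
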